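(* Let $\widehat\Sigma\in\mathbb{R}^{n\times n}$ be symmetric strictly positive definite, and let $(H_t,D_t)_{t\ge0}$ be generated by $$H_{t+1}=\widehat\Sigma(H_tH_t^\top+D_t)^{-1}H_tR_t^{-1/2},\qquad D_{t+1}=\Delta(\widehat\Sigma-H_{t+1}H_{t+1}^\top),$$ $$R_t=I-H_t^\top(H_tH_t^\top+D_t)^{-1}H_t+H_t^\top(H_tH_t^\top+D_t)^{-1}\widehat\Sigma(H_tH_t^\top+D_t)^{-1}H_t.$$ Put $\mathcal H_t=H_tH_t^\top$, and let $\mathcal H_0=H_0H_0^\top$ and $D_0$ be such that $\mathcal H_0+D_0$ is invertible. Then for all $t\ge 0$ the update equation for $\mathcal H_t$ is $$\mathcal H_{t+1}=\widehat\Sigma(\mathcal H_t+D_t)^{-1}\mathcal H_t\big(D_t+\widehat\Sigma(\mathcal H_t+D_t)^{-1}\mathcal H_t\big)^{-1}\widehat\Sigma.$$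
   Context: $n,k$ are positive integers with $k<n$, $H_0\in\mathbb{R}^{n\times k}$, and $D_0\in\mathbb{R}^{n\times n}$ is diagonal with $D_0\ge0$. For a square matrix $M$, $\Delta(M)$ is the diagonal matrix with the same diagonal as $M$. $R_t^{1/2}$ is a symmetric square root of the strictly positive definite matrix $R_t$, and $R_t^{-1/2}$ its inverse. *)

(* Defs.v *)
From HB Require Import structures.
From mathcomp Require Import all_boot all_order all_algebra.
From mathcomp Require Import reals.

Set Implicit Arguments.
Unset Strict Implicit.
Unset Printing Implicit Defensive.

Import Order.TTheory GRing.Theory Num.Theory.
Local Open Scope ring_scope.

Definition posdefmx (R : realType) (n : nat) (A : 'M[R]_n) : Prop :=
  A^T = A /\ forall x : 'cV[R]_n, x != 0 -> 0 < (x^T *m A *m x) 0 0.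

Definition diagonal_part (R : realType) (n : nat) (A : 'M[R]_n) : 'M[R]_n :=
  diag_mx (\row_(i < n) A i i).

(* Any symmetric root is allowed, not only the positive semidefinite one. *)
Definition is_sym_sqrt (R : realType) (n : nat) (S A : 'M[R]_n) : Prop :=
  S^T = S /\ S *m S = A.

Definition Rmat (R : realType) (n k : nat) (Sigma : 'M[R]_n)
    (H : 'M[R]_(n, k)) (D : 'M[R]_n) : 'M[R]_k :=
  let V := invmx (H *m H^T + D) in
  1%:M - H^T *m V *m H + H^T *m V *m Sigma *m V *m H.

(* S t is the symmetric root of R_t chosen at step t; it varies freely, so the
   sequences need not be functions of the initial condition alone. *)
Definition generated_by (R : realType) (n k : nat) (Sigma : 'M[R]_n)
    (H : nat -> 'M[R]_(n, k)) (D : nat -> 'M[R]_n) (S : nat -> 'M[R]_k)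
    : Prop :=
  forall t : nat,
    [/\ is_sym_sqrt (S t) (Rmat Sigma (H t) (D t)),
        H t.+1 = Sigma *m invmx (H t *m (H t)^T + D t) *m H t *m invmx (S t) &
        D t.+1 = diagonal_part (Sigma - H t.+1 *m (H t.+1)^T)].

(* Main.v *)
Require Import Defs.
From HB Require Import structures.
From mathcomp Require Import all_boot all_order all_algebra.
From mathcomp Require Import reals lra.

Set Implicit Arguments.
Unset Strict Implicit.

Import Order.TTheory GRing.Theory Num.Theory.
Local Open Scope ring_scope.

(** Write M = H H^T + D and G = M^-1 H for the current state, and call the state
    admissible when D is diagonal with nonnegative entries and M is invertible.

    The formula for one step comes from the identity [push_through]
      H^T M^-1 E = R H^T,  where E = D + Sigma M^-1 H H^T.
    Once R and E are known to be invertible, it gives R^-1 H^T M^-1 = H^T E^-1.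
    The next H H^T is Sigma G S^-1 S^-1 G^T Sigma = Sigma G R^-1 H^T M^-1 Sigma,
    and replacing R^-1 H^T M^-1 there is the claim. Invertibility of E also
    follows from the identity: a vector killed by E is killed by R H^T, hence by
    H^T, hence by D, hence by M.

    Invertibility of R holds because R = (1 - H^T G) + G^T Sigma G is a sum of
    two positive semidefinite matrices ([psdmx_innovation]). A vector x in its
    kernel is killed by both; definiteness of Sigma then gives G x = 0, and so
    x = H^T G x = 0.

    To iterate, the next state has to be admissible again ([admissible_next]).
    The residual A = Sigma - Sigma G R^-1 G^T Sigma is a Schur complement, hence
    positive semidefinite ([psdmx_schur]), and its diagonal part is nonnegative.
    A vector killed by the next H H^T + Delta(A) is killed by H H^T and by
    Delta(A). It is therefore supported on the zero diagonal entries of A, whose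
    columns vanish because A is semidefinite; so it is killed by A and by
    Sigma = A + H H^T, and it is zero. *)

(** * Positive semidefinite matrices *)

Definition psdmx (F : realFieldType) (n : nat) (A : 'M[F]_n) : Prop :=
  A^T = A /\ forall x : 'cV[F]_n, 0 <= (x^T *m A *m x) 0 0.

Lemma unitmx_ker0 (F : fieldType) (n : nat) (A : 'M[F]_n) :
  (forall x : 'cV[F]_n, A *m x = 0 -> x = 0) -> A \in unitmx.
Proof.
move=> kerA; rewrite -unitmx_tr -row_free_unit -kermx_eq0.
apply/eqP/row_matrixP => i; rewrite row0; apply: trmx_inj; rewrite trmx0.
apply: kerA; apply: trmx_inj.
by rewrite trmx_mul trmxK -row_mul mulmx_ker row0 trmx0.
Qed.

Lemma unitmx_mul0 (F : fieldType) (n m : nat) (A : 'M[F]_n) (x : 'M[F]_(n, m)) :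
  A \in unitmx -> A *m x = 0 -> x = 0.
Proof. by move=> uA Ax0; rewrite -[x](mulKmx uA) Ax0 mulmx0. Qed.

Lemma trmx_self_mul_ge0 (F : realFieldType) (n : nat) (x : 'cV[F]_n) :
  0 <= (x^T *m x) 0 0.
Proof. by rewrite mxE sumr_ge0 // => i _; rewrite mxE -expr2 sqr_ge0. Qed.

Lemma trmx_self_mul_eq0 (F : realFieldType) (n : nat) (x : 'cV[F]_n) :
  (x^T *m x) 0 0 = 0 -> x = 0.
Proof.
rewrite mxE => /eqP; rewrite psumr_eq0 => [/allP x0|i _]; last first.
  by rewrite mxE -expr2 sqr_ge0.
apply/colP => i; have := x0 i (mem_index_enum i).
by rewrite /= !mxE -expr2 sqrf_eq0 => /eqP.
Qed.

Lemma psdmx_add (F : realFieldType) (n : nat) (A B : 'M[F]_n) :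
  psdmx A -> psdmx B -> psdmx (A + B).
Proof.
move=> [sA pA] [sB pB]; split=> [|x].
  by rewrite [(_ + _)^T]linearD /= sA sB.
by rewrite mulmxDr mulmxDl mxE addr_ge0.
Qed.

Lemma psdmx_congr (F : realFieldType) (n m : nat) (A : 'M[F]_n)
    (B : 'M[F]_(n, m)) :
  psdmx A -> psdmx (B^T *m A *m B).
Proof.
move=> [sA pA]; split=> [|x]; first by rewrite !trmx_mul trmxK sA mulmxA.
by have := pA (B *m x); rewrite trmx_mul !mulmxA.
Qed.

Lemma psdmx_gram (F : realFieldType) (n m : nat) (B : 'M[F]_(n, m)) :
  psdmx (B^T *m B).
Proof.
split=> [|x]; first by rewrite trmx_mul trmxK.
by have := trmx_self_mul_ge0 (B *m x); rewrite trmx_mul !mulmxA.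
Qed.

Lemma psdmx_diag (F : realFieldType) (n : nat) (D : 'M[F]_n) :
  is_diag_mx D -> (forall i, 0 <= D i i) -> psdmx D.
Proof.
move=> /diag_mxP[d ->] d0; split=> [|x]; first by rewrite tr_diag_mx.
rewrite mxE sumr_ge0 // => i _; rewrite mul_mx_diag !mxE mulrAC -expr2.
by rewrite mulr_ge0 ?sqr_ge0 //; have := d0 i; rewrite mxE eqxx.
Qed.

(** If x^T A x = 0 while y := A x is nonzero, then the quadratic form is affine
    and nonconstant along the line y + c x, hence takes negative values. *)
Lemma psdmx_ker (F : realFieldType) (n : nat) (A : 'M[F]_n) (x : 'cV[F]_n) :
  psdmx A -> (x^T *m A *m x) 0 0 = 0 -> A *m x = 0.
Proof.
move=> [sA pA] qx0; set y := A *m x.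
apply: trmx_self_mul_eq0; apply/eqP; apply: contraT => b0.
set b := (y^T *m y) 0 0 in b0; set q := (y^T *m A *m y) 0 0.
have line c : ((y + c *: x)^T *m A *m (y + c *: x)) 0 0 = q + (c * b) *+ 2.
  have xA : x^T *m A = y^T by rewrite trmx_mul sA.
  rewrite [_^T]linearD /= [(_ *: _)^T]linearZ /= !mulmxDl !mulmxDr.
  rewrite -!scalemxAl -!scalemxAr.
  rewrite -(mulmxA _ A x) -/y.
  rewrite xA in qx0 *; rewrite /q /b; move: (_ *m A *m _) => Q.
  move: (y^T *m y) (y^T *m x) qx0 => Y X X0.
  by rewrite !mxE X0 !mulr0 addr0 -addrA mulr2n.
(* This c makes the form take the value q - 2 (q + 1), which is negative. *)
have := pA (y - ((q + 1) / b) *: x); rewrite -scaleNr line mulNr divfK //.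
have := pA y; rewrite -/q mulr2n; lra.
Qed.

Lemma psdmx_add_ker (F : realFieldType) (n : nat) (A B : 'M[F]_n)
    (x : 'cV[F]_n) :
  psdmx A -> psdmx B -> (A + B) *m x = 0 -> A *m x = 0 /\ B *m x = 0.
Proof.
move=> psA psB ABx.
have [pA pB] := (psA.2 x, psB.2 x).
have : (x^T *m ((A + B) *m x)) 0 0 = 0 by rewrite ABx mulmx0 mxE.
rewrite mulmxDl mulmxDr !mulmxA mxE => /eqP.
by rewrite paddr_eq0 // => /andP[/eqP qA /eqP qB]; split; apply: psdmx_ker.
Qed.

Lemma quad_delta_mx (F : realFieldType) (n : nat) (A : 'M[F]_n) (i : 'I_n) :
  ((delta_mx i 0 : 'cV[F]_n)^T *m A *m (delta_mx i 0 : 'cV[F]_n)) 0 0 = A i i.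
Proof. by rewrite -mulmxA -colE trmx_delta -rowE !mxE. Qed.

(** Each vanishing diagonal entry of a positive semidefinite A forces the whole
    column to vanish, so Delta(A) cannot kill more than A does. *)
Lemma psdmx_diagonal_ker (R : realType) (n : nat) (A : 'M[R]_n)
    (x : 'cV[R]_n) :
  psdmx A -> diagonal_part A *m x = 0 -> A *m x = 0.
Proof.
move=> psA Dx; apply/colP => j; rewrite !mxE big1 // => i _.
have := congr1 (fun v : 'cV_n => v i 0) Dx.
rewrite /diagonal_part mul_diag_mx !mxE => /eqP.
rewrite mulf_eq0 => /orP[/eqP Aii|/eqP ->]; last by rewrite mulr0.
have qi := quad_delta_mx A i; rewrite Aii in qi.
have := congr1 (fun v : 'cV_n => v j 0) (psdmx_ker psA qi).
by rewrite -colE !mxE => ->; rewrite mul0r.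
Qed.

Lemma psdmx_diagonal_ge0 (F : realFieldType) (n : nat) (A : 'M[F]_n)
    (i : 'I_n) :
  psdmx A -> 0 <= A i i.
Proof.
by move=> [_ /(_ (delta_mx i 0))]; rewrite quad_delta_mx.
Qed.

(** With K = R^-1 G^T Q, the Schur complement equals the manifestly semidefinite
    (1 - G K)^T Q (1 - G K) + K^T P K: expanding, the two terms quadratic in K
    combine to K^T R K = Q G K. *)
Lemma psdmx_schur (F : realFieldType) (n k : nat) (Q : 'M[F]_n) (P : 'M[F]_k)
    (G : 'M[F]_(n, k)) :
  psdmx Q -> psdmx P -> P + G^T *m Q *m G \in unitmx ->
  psdmx (Q - Q *m G *m invmx (P + G^T *m Q *m G) *m G^T *m Q).
Proof.
move=> psQ psP; set R := P + _ => uR.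
have sR : R^T = R by case: (psdmx_add psP (psdmx_congr G psQ)).
set K := invmx R *m G^T *m Q.
have trK : K^T = Q *m G *m invmx R.
  by rewrite !trmx_mul trmxK trmx_inv sR psQ.1 mulmxA.
have KRK : K^T *m R *m K = Q *m G *m K by rewrite trK mulmxKV.
have KGQ : K^T *m G^T *m Q = Q *m G *m K by rewrite trK /K !mulmxA.
have -> : Q *m G *m invmx R *m G^T *m Q = Q *m G *m K by rewrite /K !mulmxA.
move: K {trK} KRK KGQ => K KRK KGQ.
suff -> : Q - Q *m G *m K =
    (1%:M - G *m K)^T *m Q *m (1%:M - G *m K) + K^T *m P *m K.
  exact: psdmx_add (psdmx_congr _ psQ) (psdmx_congr _ psP).
have -> : K^T *m P *m K = Q *m G *m K - Q *m G *m K *m G *m K.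
  by rewrite -{1}KRK -KGQ /R mulmxDr mulmxDl !mulmxA addrK.
rewrite [(_ - _)^T]linearB /= trmx1 trmx_mul mulmxBl mul1mx KGQ.
by rewrite mulmxBr mulmx1 !mulmxBl !mulmxA subrK.
Qed.

(** * One step of the recursion *)

Definition admissible (R : realType) (n k : nat) (H : 'M[R]_(n, k))
    (D : 'M[R]_n) : Prop :=
  [/\ is_diag_mx D, forall i, 0 <= D i i & H *m H^T + D \in unitmx].

Lemma posdefmx_psd (R : realType) (n : nat) (A : 'M[R]_n) :
  posdefmx A -> psdmx A.
Proof.
move=> [sA pA]; split=> // x; have [->|x0] := eqVneq x 0.
  by rewrite mulmx0 mxE.
by rewrite ltW ?pA.
Qed.

Lemma posdefmx_unit (R : realType) (n : nat) (A : 'M[R]_n) :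
  posdefmx A -> A \in unitmx.
Proof.
move=> [_ pA]; apply: unitmx_ker0 => x Ax0; apply/eqP; apply: contraT => x0.
by have := pA x x0; rewrite -mulmxA Ax0 mulmx0 mxE ltxx.
Qed.

Lemma sym_sqrt_invmx (R : realType) (n : nat) (S A : 'M[R]_n) :
  is_sym_sqrt S A -> A \in unitmx -> invmx S *m (invmx S)^T = invmx A.
Proof.
move=> [sS SS] uA; have uS : S \in unitmx.
  by move: uA; rewrite -SS unitmx_mul => /andP[].
rewrite trmx_inv sS; apply: (can_inj (mulKmx uA)).
by rewrite [RHS](mulmxV uA) -SS -mulmxA mulKVmx // mulmxV.
Qed.

(** With M = H H^T + D, W = H^T M^-1 H and G = M^-1 H, expanding the middle
    factor of W = G^T M G gives W = W^2 + G^T D G. As W is symmetric, 1 - W is then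
    (1 - W)^T (1 - W) + G^T D G. *)
Lemma psdmx_innovation (F : realFieldType) (n k : nat) (H : 'M[F]_(n, k))
    (D : 'M[F]_n) :
  psdmx D -> H *m H^T + D \in unitmx ->
  psdmx (1%:M - H^T *m invmx (H *m H^T + D) *m H).
Proof.
move=> psD; set M := _ + D => uM; set V := invmx M.
have sM : M^T = M by rewrite [(_ + _)^T]linearD /= trmx_mul trmxK psD.1.
have sV : V^T = V by rewrite trmx_inv sM.
set W := H^T *m V *m H.
have sW : W^T = W by rewrite !trmx_mul trmxK sV mulmxA.
have WE : W = W *m W + (V *m H)^T *m D *m (V *m H).
  have -> : W *m W = (V *m H)^T *m (H *m H^T) *m (V *m H).
    by rewrite trmx_mul sV /W !mulmxA.
  by rewrite -mulmxDl -mulmxDr -/M trmx_mul sV mulmxA mulmxKV // mulmxA.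
suff -> : 1%:M - W =
    (1%:M - W)^T *m (1%:M - W) + (V *m H)^T *m D *m (V *m H).
  exact: psdmx_add (psdmx_gram _) (psdmx_congr _ psD).
have -> : (V *m H)^T *m D *m (V *m H) = W - W *m W.
  by rewrite {1}WE addrAC subrr add0r.
rewrite [(_ - _)^T]linearB /= trmx1 sW mulmxBl mul1mx mulmxBr mulmx1.
by rewrite subrK.
Qed.

Lemma admissible_psd (R : realType) (n k : nat) (H : 'M[R]_(n, k)) D :
  admissible H D -> psdmx D.
Proof. by case=> dD pD _; apply: psdmx_diag. Qed.

Lemma RmatE (R : realType) (n k : nat) (Sigma : 'M[R]_n)
    (H : 'M[R]_(n, k)) (D : 'M[R]_n) :
  psdmx D ->
  Rmat Sigma H D =
    (1%:M - H^T *m invmx (H *m H^T + D) *m H)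
    + (invmx (H *m H^T + D) *m H)^T *m Sigma *m (invmx (H *m H^T + D) *m H).
Proof.
move=> psD; rewrite /Rmat trmx_mul trmx_inv.
have -> : (H *m H^T + D)^T = H *m H^T + D.
  by rewrite [(_ + _)^T]linearD /= trmx_mul trmxK psD.1.
by rewrite !mulmxA.
Qed.

(** Strict definiteness of Sigma is what makes the second summand of R detect
    G x, where G = M^-1 H; on the kernel of G the first summand acts as the
    identity. *)
Lemma Rmat_unit (R : realType) (n k : nat) (Sigma : 'M[R]_n)
    (H : 'M[R]_(n, k)) (D : 'M[R]_n) :
  posdefmx Sigma -> admissible H D -> Rmat Sigma H D \in unitmx.
Proof.
move=> pS aHD; have psD := admissible_psd aHD; have [_ _ uM] := aHD.
rewrite RmatE //; apply: unitmx_ker0 => x.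
case/(psdmx_add_ker (psdmx_innovation psD uM)
        (psdmx_congr _ (posdefmx_psd pS))).
rewrite -(mulmxA H^T); move: (invmx _ *m H) => G Px Qx.
have Gx : G *m x = 0.
  apply/eqP; apply: contraT => Gx0; have := pS.2 _ Gx0.
  by rewrite trmx_mul !mulmxA -!(mulmxA x^T) Qx mulmx0 mxE ltxx.
by move: Px; rewrite mulmxBl mul1mx -mulmxA Gx mulmx0 subr0.
Qed.

(** From M = H H^T + D one gets H^T M^-1 D = H^T - H^T M^-1 H H^T; adding
    H^T M^-1 Sigma M^-1 H H^T to both sides factors out H^T on the right. *)
Lemma push_through (R : realType) (n k : nat) (Sigma : 'M[R]_n)
    (H : 'M[R]_(n, k)) (D : 'M[R]_n) :
  H *m H^T + D \in unitmx ->
  H^T *m invmx (H *m H^T + D)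
    *m (D + Sigma *m invmx (H *m H^T + D) *m (H *m H^T))
  = Rmat Sigma H D *m H^T.
Proof.
rewrite /Rmat; set M := _ + D => uM; set V := invmx M.
have -> : D = M - H *m H^T by rewrite /M addrAC subrr add0r.
rewrite mulmxDr mulmxBr mulmxKV // mulmxDl mulmxBl mul1mx.
by rewrite !mulmxA.
Qed.

(** The kernel of E = D + Sigma M^-1 H H^T is read off from [push_through]: R is
    invertible, so E x = 0 forces H^T x = 0, and what is left of E x is D x. *)
Lemma update_factor_unit (R : realType) (n k : nat) (Sigma : 'M[R]_n)
    (H : 'M[R]_(n, k)) (D : 'M[R]_n) :
  posdefmx Sigma -> admissible H D ->
  D + Sigma *m invmx (H *m H^T + D) *m (H *m H^T) \in unitmx.
Proof.
move=> pS aHD; have [_ _ uM] := aHD.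
apply: unitmx_ker0 => x Ex.
have Hx : H^T *m x = 0.
  apply: (unitmx_mul0 (Rmat_unit pS aHD)).
  by rewrite mulmxA -(push_through _ uM) -(mulmxA _ _ x) Ex mulmx0.
have Dx : D *m x = 0.
  by move: Ex; rewrite mulmxDl -!mulmxA Hx !mulmx0 addr0.
by apply: (unitmx_mul0 uM); rewrite mulmxDl -mulmxA Hx Dx mulmx0 addr0.
Qed.

(** The chosen root S enters only through S^-1 S^-1 = R^-1, so the update of
    H H^T does not depend on that choice. *)
Lemma next_gramE (R : realType) (n k : nat) (Sigma : 'M[R]_n)
    (H H' : 'M[R]_(n, k)) (D : 'M[R]_n) (S : 'M[R]_k) :
  posdefmx Sigma -> admissible H D -> is_sym_sqrt S (Rmat Sigma H D) ->
  H' = Sigma *m invmx (H *m H^T + D) *m H *m invmx S ->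
  H' *m H'^T = Sigma *m (invmx (H *m H^T + D) *m H)
    *m invmx (Rmat Sigma H D) *m (invmx (H *m H^T + D) *m H)^T *m Sigma.
Proof.
move=> pS aHD sqS ->; rewrite -(sym_sqrt_invmx sqS (Rmat_unit pS aHD)).
by rewrite -[Sigma *m _ *m H]mulmxA !trmx_mul pS.1 !mulmxA.
Qed.

Lemma gram_update (R : realType) (n k : nat) (Sigma : 'M[R]_n)
    (H H' : 'M[R]_(n, k)) (D : 'M[R]_n) (S : 'M[R]_k) :
  posdefmx Sigma -> admissible H D -> is_sym_sqrt S (Rmat Sigma H D) ->
  H' = Sigma *m invmx (H *m H^T + D) *m H *m invmx S ->
  H' *m H'^T = Sigma *m invmx (H *m H^T + D) *m (H *m H^T)
    *m invmx (D + Sigma *m invmx (H *m H^T + D) *m (H *m H^T)) *m Sigma.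
Proof.
move=> pS aHD sqS HE; rewrite (next_gramE pS aHD sqS HE).
have [_ _ uM] := aHD; have uR := Rmat_unit pS aHD.
have uE := update_factor_unit pS aHD.
have sM : (H *m H^T + D)^T = H *m H^T + D.
  by rewrite [(_ + _)^T]linearD /= trmx_mul trmxK (admissible_psd aHD).1.
have := push_through Sigma uM.
set M := H *m H^T + D in uM uE sM *; set E := D + _ in uE *.
set Q := Rmat _ _ _ in uR * => push.
have {push}move_inv : invmx Q *m (H^T *m invmx M) = H^T *m invmx E.
  apply: (can_inj (mulKmx uR)); rewrite mulKVmx // mulmxA -push.
  by rewrite mulmxK.
rewrite trmx_mul trmx_inv sM.
by rewrite -[_ *m invmx Q *m _]mulmxA move_inv !mulmxA.
Qed.

(** The residual A = Sigma - H' H'^T is a Schur complement, so semidefinite. A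
    vector killed by H' H'^T + Delta(A) is killed by both summands, hence by A,
    hence by Sigma = A + H' H'^T. *)
Lemma admissible_next (R : realType) (n k : nat) (Sigma : 'M[R]_n)
    (H H' : 'M[R]_(n, k)) (D : 'M[R]_n) (S : 'M[R]_k) :
  posdefmx Sigma -> admissible H D -> is_sym_sqrt S (Rmat Sigma H D) ->
  H' = Sigma *m invmx (H *m H^T + D) *m H *m invmx S ->
  admissible H' (diagonal_part (Sigma - H' *m H'^T)).
Proof.
move=> pS aHD sqS HE; have psD := admissible_psd aHD; have [_ _ uM] := aHD.
have psA : psdmx (Sigma - H' *m H'^T).
  have uR := Rmat_unit pS aHD.
  rewrite (next_gramE pS aHD sqS HE); move: uR; rewrite RmatE //.
  exact: psdmx_schur (posdefmx_psd pS) (psdmx_innovation psD uM).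
have diag0 i : 0 <= diagonal_part (Sigma - H' *m H'^T) i i.
  by have := psdmx_diagonal_ge0 i psA; rewrite /diagonal_part !mxE eqxx.
have diagA : is_diag_mx (diagonal_part (Sigma - H' *m H'^T)).
  exact: diag_mx_is_diag.
split=> //; apply: unitmx_ker0 => x.
have psG : psdmx (H' *m H'^T) by have := psdmx_gram H'^T; rewrite trmxK.
case/(psdmx_add_ker psG (psdmx_diag diagA diag0)) => Gx.
move=> /(psdmx_diagonal_ker psA); rewrite mulmxBl Gx subr0.
exact: unitmx_mul0 (posdefmx_unit pS).
Qed.

Unset Implicit Arguments.

Theorem proposition5p3 (R : realType) (n k : nat) (k_gt0 : (0 < k)%N)
    (k_lt_n : (k < n)%N) (Sigma : 'M[R]_n) (H0 : 'M[R]_(n, k)) (D0 : 'M[R]_n)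
    (H : nat -> 'M[R]_(n, k)) (D : nat -> 'M[R]_n) (S : nat -> 'M[R]_k)
    (Sigma_pos : posdefmx Sigma)
    (D0_diag : is_diag_mx D0) (D0_ge0 : forall i : 'I_n, 0 <= D0 i i)
    (M0_unit : H0 *m H0^T + D0 \in unitmx)
    (H_init : H 0%N = H0) (D_init : D 0%N = D0)
    (HD_gen : generated_by Sigma H D S) :
  let HH := fun t : nat => H t *m (H t)^T in
  forall t : nat,
    [/\ HH t + D t \in unitmx,
        D t + Sigma *m invmx (HH t + D t) *m HH t \in unitmx &
        HH t.+1 =
          Sigma *m invmx (HH t + D t) *m HH t
          *m invmx (D t + Sigma *m invmx (HH t + D t) *m HH t) *m Sigma].
Proof.
move=> HH t; have aHD : admissible (H t) (D t).
  elim: t => [|t IHt]; first by rewrite H_init D_init.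
  by have [sqS HE ->] := HD_gen t; apply: admissible_next Sigma_pos IHt sqS HE.
have [sqS HE _] := HD_gen t; have [_ _ uM] := aHD.
split; [exact: uM | exact: update_factor_unit Sigma_pos aHD |].
exact: gram_update Sigma_pos aHD sqS HE.
Qed.
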